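(* Let $n\in\mathbb{N}$ and $x\in[n]$. Let $G$ be a graph whose vertices form a subset of $[n]\setminus\{x\}$, and let $T$ be a full (induced) subgraph of $G$. Assume that the following conditions hold: (i) $T$ is a triangulation of a polygon, and $x-1$ and $x+1$ are vertices of $T$. (ii) All vertices of $G$ that are not in $T$ have degree $1$. (iii) Every vertex $l$ of degree $1$ is adjacent either to the maximal (with respect to $<_x$) vertex $v\in T$ with $v<_x l$ or to the minimal vertex $v\in T$ with $l<_x v$. (iv) Let $t_1$ and $t_2$ be vertices of $T$ with $t_1<_x t_2$. If $l_1$ is a leaf of $G$ adjacent to $t_1$ and $l_2$ is a leaf of $G$ adjacent to $t_2$, then $l_1<_x l_2$. (v) $x-2$ and $x+2$ are vertices of $G$, and $\{x-2,x-1\}$ and $\{x+1,x+2\}$ are edges of $G$. Then there is a maximal weakly separated family $\mathscr{F}$ of triangles in $[n]$ such that $G(\mathscr{F}_x)=G$.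
   Context: Let $[n]=\{1,\dots,n\}$; elements such as $x\pm1,x\pm2$ are taken modulo $n$. A tuple $(a_1,\dots,a_r)$, $r\ge 3$, of pairwise distinct elements of $[n]$ is cyclically ordered if $a_1<\dots<a_r$ or there is $2\le i\le r$ with $a_i<a_{i+1}<\dots<a_r<a_1<\dots<a_{i-1}$. For distinct $a,b\in[n]\setminus\{x\}$ write $a<_x b$ if $(x,a,b)$ is cyclically ordered; this is a total order on $[n]\setminus\{x\}$. A triangle is a subset of $[n]$ with exactly $3$ elements. Two triangles $A,B$ are crossing if there are $a,c\in A\setminus B$ and $b,d\in B\setminus A$ such that $(a,b,c,d)$ is cyclically ordered; otherwise they are weakly separated. A weakly separated family of triangles is a set of pairwise non-crossing triangles in $[n]$; it is maximal if it is not properly contained in another weakly separated family of triangles in $[n]$. For a weakly separated family $\mathscr{F}$ put $\mathscr{F}_x=\{C\in\mathscr{F}\mid x\in C\}$. The graph $G(\mathscr{F}_x)$ has as vertices the elements of $[n]\setminus\{x\}$ that occur in some triangle of $\mathscr{F}_x$, and has an edge between $a$ and $b$ for every triangle $\{x,a,b\}\in\mathscr{F}_x$. Graphs are simple. A leaf of a graph is a vertex of degree $1$. A graph equipped with a cyclic order on its vertices (here the one inherited from $[n]$) is a triangulation of a polygon if (i) neighbouring vertices in the cyclic order are joined by an edge, (ii) no two edges cross each other (vertices being placed in cyclic order on a circle and edges drawn as chords), and (iii) all inner regions of the graph are triangles. By convention, a triangulation of a $2$-gon is two vertices joined by an edge. *)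

(* Defs.v *)
From mathcomp Require Import all_boot.

Set Implicit Arguments.
Unset Strict Implicit.
Unset Printing Implicit Defensive.

(* Throughout, [n] is modelled by 'I_n = {0, ..., n-1}; the shift by one
   preserves the order and the addition modulo n, so x+1 and x-1 are
   [ordS x] and [ord_pred x]. *)

Definition cyc_ordered (n : nat) (s : seq 'I_n) : bool :=
  (2 < size s)
  && [exists i : 'I_(size s), sorted ltn (rot i [seq val a | a <- s])].

Definition cyc_lt (n : nat) (x a b : 'I_n) : bool := cyc_ordered [:: x; a; b].

(* For two-element sets this says that the chords A and B of a circle cross. *)
Definition crossing (n : nat) (A B : {set 'I_n}) : bool :=
  [exists a in A :\: B, exists b in B :\: A,
   exists c in A :\: B, exists d in B :\: A, cyc_ordered [:: a; b; c; d]].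

Definition triangle (n : nat) (A : {set 'I_n}) : bool := #|A| == 3.

Definition ws_family (n : nat) (F : {set {set 'I_n}}) : bool :=
  [forall A in F, triangle A]
  && [forall A in F, forall B in F, ~~ crossing A B].

Definition maximal_ws_family (n : nat) (F : {set {set 'I_n}}) : bool :=
  maxset (@ws_family n) F.

(* The well-formedness condition is boolean, so Leibniz equality of graphs is
   equality of vertex sets and of edge sets. *)
Record sgraph (V : finType) := SGraph {
  vset : {set V};
  eset : {set {set V}};
  _ : [forall e in eset, (#|e| == 2) && (e \subset vset)]
}.

Definition adjacent (V : finType) (G : sgraph V) (a b : V) : bool :=
  [set a; b] \in eset G.

Definition degree (V : finType) (G : sgraph V) (v : V) : nat :=
  #|[set e in eset G | v \in e]|.

Definition leaf (V : finType) (G : sgraph V) (v : V) : bool :=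
  (v \in vset G) && (degree G v == 1).

Definition full_subgraph (V : finType) (T G : sgraph V) : Prop :=
  vset T \subset vset G /\ eset T = [set e in eset G | e \subset vset T].

Definition family_at (n : nat) (F : {set {set 'I_n}}) (x : 'I_n) :
    {set {set 'I_n}} :=
  [set C in F | x \in C].

Lemma graph_at_subproof (n : nat) (F : {set {set 'I_n}}) (x : 'I_n) :
  [forall e in [set e : {set 'I_n} |
                [&& #|e| == 2, x \notin e & x |: e \in family_at F x]],
   (#|e| == 2) &&
   (e \subset [set a | (a != x) && [exists C in family_at F x, a \in C]])].
Proof.
apply/forall_inP => e; rewrite inE => /and3P[-> xe Fe] /=.
apply/subsetP => a ae; rewrite inE; apply/andP; split.
  by apply: contraNneq xe => <-.
by apply/exists_inP; exists (x |: e) => //; rewrite !inE ae orbT.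
Qed.

(* The graph G(F_x): a two-element set e = {a, b} avoiding x is an edge
   exactly when {x, a, b} belongs to F. *)
Definition graph_at (n : nat) (F : {set {set 'I_n}}) (x : 'I_n) :
    sgraph 'I_n :=
  SGraph (graph_at_subproof F x).

(* b directly follows a in the cyclic order that W inherits from 'I_n; when W
   has two elements, each of them follows the other. *)
Definition cyc_next (n : nat) (W : {set 'I_n}) (a b : 'I_n) : bool :=
  [&& a \in W, b \in W, a != b & [forall c in W, ~~ cyc_ordered [:: a; c; b]]].

(* With the vertices on a circle, the edges drawn as chords without crossings
   and the sides of the polygon present, the inner regions are the convex
   polygons whose sides are edges and whose diagonals are not; W is the set of
   corners of such a polygon. *)
Definition inner_region (n : nat) (G : sgraph 'I_n) (W : {set 'I_n}) : Prop :=
  [/\ W \subset vset G,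
      2 < #|W|,
      forall a b : 'I_n, cyc_next W a b -> adjacent G a b
    & forall a b : 'I_n, a \in W -> b \in W -> adjacent G a b ->
        cyc_next W a b || cyc_next W b a].

(* For two vertices the last condition is vacuous and the first one says that
   they are joined, which is the convention for the 2-gon. *)
Definition polygon_triangulation (n : nat) (G : sgraph 'I_n) : Prop :=
  [/\ 1 < #|vset G|,
      forall a b : 'I_n, cyc_next (vset G) a b -> adjacent G a b,
      forall e f : {set 'I_n}, e \in eset G -> f \in eset G -> ~~ crossing e f
    & forall W : {set 'I_n}, inner_region G W -> #|W| = 3].

(* v is the largest element of W below l, respectively the smallest element of
   W above l, with respect to the total order [cyc_lt x]. *)
Definition max_below (n : nat) (x : 'I_n) (W : {set 'I_n}) (l v : 'I_n) : bool :=
  [&& v \in W, cyc_lt x v l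
    & [forall w in W, cyc_lt x w l ==> (w == v) || cyc_lt x w v]].

Definition min_above (n : nat) (x : 'I_n) (W : {set 'I_n}) (l v : 'I_n) : bool :=
  [&& v \in W, cyc_lt x l v
    & [forall w in W, cyc_lt x l w ==> (w == v) || cyc_lt x v w]].

(* Main.v *)
Require Import Defs.
From mathcomp Require Import all_boot zify.

Set Implicit Arguments.
Unset Strict Implicit.
Unset Printing Implicit Defensive.

(** Place 0, ..., n-1 on a circle and cut the circle at x. Every vertex of
    G gets a position between 1 and n-1, and a triangle {x, a, b} crosses
    {x, c, d} exactly when the chords ab and cd cross. No two edges of G
    cross: inside T this is part of being a triangulation, a leaf edge
    stays between two consecutive vertices s, t of T, and by the order
    condition on leaves the leaves of s come before those of t. So the cone
    {x + e | e an edge of G} is weakly separated.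

    A maximal family containing the cone may have further triangles at x.
    To exclude them, the cone is completed by triangles which avoid x and
    make every {x, a, b} with ab not an edge impossible. These form the
    fan: all {t, u, w} where t is a vertex of T and u, w are consecutive
    neighbours of t, neither of them separated from t by a vertex of T. Fan
    triangles cross neither each other nor the cone (lemmas fan_fan and
    cone_fan); requiring u and w to be near t is essential, since a face
    {t, u, w} of T with an edge of G strictly between u and w would cross
    the cone.

    Now let ab be a non-edge (lemma blocked). If a and b both lie in T,
    some edge of T crosses ab, because a triangulation has no room for
    another diagonal. Otherwise b, say, lies strictly between consecutive
    vertices s, t of T. If a lies beyond s or t, then ab crosses the side
    st. If a = s, then b lies between two consecutive neighbours u, w of s,
    and {s, u, w} crosses {x, s, b}. These u and w exist on both sides of b
    because s has polygon neighbours on both sides, or else s = x+1, where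
    the edge from x+1 to x+2 takes over, or s = x-1 symmetrically. If s < a
    < b < t, then sb and ta cannot both be edges, as they would cross; if
    sb is not an edge, the neighbours u, w of s around b give either an
    edge su crossing ab or a fan triangle {s, u, w} crossing {x, a, b}.
    Hence any maximal family extending the cone and the fan has link G at
    x. *)

(** * Positions on the circle cut at a point *)

Definition pos (n : nat) (x a : 'I_n) : nat :=
  if x <= a then a - x else a + n - x.

Definition between (j i k : nat) : bool := (i < j < k) || (k < j < i).
Definition outside (j i k : nat) : bool :=
  (j < i) && (j < k) || (i < j) && (k < j).
(** The chords ik and jl of a circle cross. *)
Definition interlaced (i k j l : nat) : bool :=
  between j i k && outside l i k || between l i k && outside j i k.

Ltac poslia := rewrite /pos /=;
  repeat match goal with |- context [if leq ?a ?b then _ else _] =>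
    case: (leqP a b) => ? end;
  repeat (case: ifP => ?); lia.
Ltac chordlia := rewrite /interlaced /between /outside; lia.

Lemma interlaced_ends i k j l : interlaced i k j l = interlaced k i j l.
Proof. chordlia. Qed.

Lemma interlaced_chords i k j l : interlaced i k j l = interlaced j l i k.
Proof. chordlia. Qed.

Section Positions.
Variables (n : nat) (x : 'I_n).
Notation p := (pos x).

Lemma pos_inj : injective p.
Proof.
move=> a b e; apply/val_inj => /=; move: e.
have := ltn_ord a; have := ltn_ord b; have := ltn_ord x; poslia.
Qed.

Lemma pos_eq a b : (p a == p b) = (a == b).
Proof. exact: (inj_eq (@pos_inj)). Qed.

Lemma pos_id : p x = 0.
Proof. by rewrite /pos leqnn subnn. Qed.

Lemma pos_gt0 a : (0 < p a) = (a != x).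
Proof. by rewrite lt0n -pos_eq pos_id. Qed.

Lemma pos_ltn a : p a < n.
Proof. have := ltn_ord a; have := ltn_ord x; poslia. Qed.

Lemma pos_ordS a : p (ordS a) = if (p a).+1 == n then 0 else (p a).+1.
Proof.
have ha := ltn_ord a; have hx := ltn_ord x.
have [an|an] := ltnP a.+1 n; first by rewrite /pos /= modn_small //; poslia.
have an1 : a.+1 = n by lia.
rewrite /pos /= an1 modnn; poslia.
Qed.

Lemma pos_ord_pred a : p (ord_pred a) = if p a == 0 then n.-1 else (p a).-1.
Proof.
have /= := pos_ordS (ord_pred a); rewrite ord_predK.
have := pos_ltn (ord_pred a); repeat (case: ifP => ?); lia.
Qed.

Lemma cyc3_val (a b c : 'I_n) :
  cyc_ordered [:: a; b; c] = [|| a < b < c, b < c < a | c < a < b].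
Proof.
rewrite /cyc_ordered /=; apply/existsP/idP.
  by case=> -[[|[|[|//]]] hi] /=; rewrite /rot /= andbT => ->; rewrite ?orbT.
by case/or3P=> h; [exists (@Ordinal 3 0 isT)|exists (@Ordinal 3 1 isT)
                  |exists (@Ordinal 3 2 isT)]; rewrite /rot /= andbT.
Qed.

Lemma cyc_ordered3 (a b c : 'I_n) :
  cyc_ordered [:: a; b; c] =
  [|| p a < p b < p c, p b < p c < p a | p c < p a < p b].
Proof.
rewrite cyc3_val.
have := ltn_ord a; have := ltn_ord b; have := ltn_ord c; have := ltn_ord x.
poslia.
Qed.

(** Reduces the invariance of the cyclic order of four points under a change of
    the cutting point to the case of three points. *)
Lemma cyc4_split (a b c d : nat) :
  [|| [&& a < b, b < c & c < d], [&& b < c, c < d & d < a],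
      [&& c < d, d < a & a < b] | [&& d < a, a < b & b < c]] =
  [|| a < b < c, b < c < a | c < a < b] &&
  [|| a < c < d, c < d < a | d < a < c].
Proof. lia. Qed.

Lemma cyc_ordered4 (a b c d : 'I_n) :
  cyc_ordered [:: a; b; c; d] =
  [|| [&& p a < p b, p b < p c & p c < p d],
      [&& p b < p c, p c < p d & p d < p a],
      [&& p c < p d, p d < p a & p a < p b]
    | [&& p d < p a, p a < p b & p b < p c]].
Proof.
have -> : cyc_ordered [:: a; b; c; d] =
  [|| [&& a < b, b < c & c < d], [&& b < c, c < d & d < a],
      [&& c < d, d < a & a < b] | [&& d < a, a < b & b < c]].
  rewrite /cyc_ordered /=; apply/existsP/idP.
    by case=> -[[|[|[|[|//]]]] hi] /=; rewrite /rot /= andbT => ->;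
      rewrite ?orbT.
  by case/or4P=> h; [exists (@Ordinal 4 0 isT)|exists (@Ordinal 4 1 isT)
     |exists (@Ordinal 4 2 isT)|exists (@Ordinal 4 3 isT)];
     rewrite /rot /= andbT.
by rewrite !cyc4_split -!cyc3_val !cyc_ordered3.
Qed.

Lemma cyc_ltE a b : cyc_lt x a b = (0 < p a < p b).
Proof. rewrite /cyc_lt cyc_ordered3 pos_id; lia. Qed.

(** Read through positions, crossing is independent of the direction of the two
    chords, so no case distinction on the cyclic order of the four points
    remains. *)
Lemma crossingP (A B : {set 'I_n}) :
  reflect (exists a b c d,
     [/\ a \in A :\: B, c \in A :\: B, b \in B :\: A, d \in B :\: A
       & interlaced (p a) (p c) (p b) (p d)])
    (crossing A B).
Proof.
apply: (iffP exists_inP).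
  case=> a Aa /exists_inP[b Bb /exists_inP[c Ac /exists_inP[d Bd]]].
  rewrite cyc_ordered4 => h; exists a, b, c, d; split=> //; move: h; chordlia.
case=> a [b [c [d [Aa Ac Bb Bd h]]]]; exists a => //; apply/exists_inP.
have [h'|h'] := boolP (cyc_ordered [:: a; b; c; d]).
  exists b => //; apply/exists_inP; exists c => //.
  by apply/exists_inP; exists d.
exists d => //; apply/exists_inP; exists c => //; apply/exists_inP.
exists b => //.
move: h h'; rewrite !cyc_ordered4; chordlia.
Qed.

Lemma crossing_sym (A B : {set 'I_n}) : crossing A B -> crossing B A.
Proof.
case/crossingP=> a [b [c [d [Aa Ac Bb Bd h]]]].
apply/crossingP; exists b, a, d, c; split=> //; move: h; chordlia.
Qed.

End Positions.

(** * Simple graphs *)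

Section Graphs.
Variable V : finType.
Implicit Types G : sgraph V.

Lemma adjacentC G a b : adjacent G a b = adjacent G b a.
Proof. by rewrite /adjacent setUC. Qed.

Lemma eset_card G e : e \in eset G -> #|e| = 2.
Proof. by case: G => W E /= /forall_inP h /h /andP[/eqP]. Qed.

Lemma eset_sub G e : e \in eset G -> e \subset vset G.
Proof. by case: G => W E /= /forall_inP h /h /andP[]. Qed.

Lemma adjacent_neq G a b : adjacent G a b -> a != b.
Proof. by move/eset_card; rewrite cards2; case: (a != b). Qed.

Lemma adjacent_vset G a b : adjacent G a b -> a \in vset G.
Proof. by move/eset_sub/subsetP; apply; rewrite set21. Qed.

Lemma sgraph_eq G1 G2 : vset G1 = vset G2 -> eset G1 = eset G2 -> G1 = G2.
Proof.
case: G1 G2 => V1 E1 h1 [V2 E2 h2] /= eV eE; subst V2 E2.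
by rewrite (bool_irrelevance h1 h2).
Qed.

Lemma edgeP G e : e \in eset G -> exists a b, adjacent G a b /\ e = [set a; b].
Proof.
move=> Ge; have /eqP/cards2P[a [b [_ eE]]] := eset_card Ge.
by exists a, b; rewrite /adjacent -eE.
Qed.

Lemma degree1_adjacent G l a b :
  degree G l = 1 -> adjacent G l a -> adjacent G l b -> a = b.
Proof.
move=> /eqP/cards1P[e eE] la lb.
have mem c : adjacent G l c -> [set l; c] = e.
  by move=> lc; apply/set1P; rewrite -eE inE set21 andbT.
have: a \in [set l; b] by rewrite (mem _ lb) -(mem _ la) set22.
by rewrite !inE eq_sym (negPf (adjacent_neq la)) => /eqP.
Qed.

Lemma degree_adjacent G l : 0 < degree G l -> exists a, adjacent G l a.
Proof.
case/card_gt0P=> e; rewrite inE => /andP[/edgeP[a [b [ab ->]]]].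
by case/set2P=> ->; [exists b|exists a; rewrite adjacentC].
Qed.

End Graphs.

(** * Triangulated polygons have no free diagonals *)

Section Diagonals.
Variables (n : nat) (x : 'I_n) (T : sgraph 'I_n).
Hypothesis triT : polygon_triangulation T.
Notation p := (pos x).

(** Cutting a polygon W along the chord cd keeps the sides of W that lie on one
    arc and creates only the side cd. *)
Lemma cyc_next_arc (W : {set 'I_n}) c d u v :
  c \in W -> d \in W -> c != d ->
  cyc_next [set w in W | ~~ cyc_ordered [:: c; d; w]] u v ->
  cyc_next W u v \/ u = d /\ v = c.
Proof.
move=> Wc Wd cd /and4P[]; rewrite !inE.
move=> /andP[Wu ud] /andP[Wv vd] uv /forall_inP h.
have hh w : w \in W -> ~~ cyc_ordered [:: c; d; w] ->
    ~~ cyc_ordered [:: u; w; v].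
  by move=> Ww wd; apply: h; rewrite inE Ww.
have := hh c Wc; have := hh d Wd; clear h.
move: (uv) (cd) ud vd; rewrite -!(pos_eq c) !(cyc_ordered3 c) pos_id.
move=> uv' cd' ud vd hd hc.
have [lt_uv|lt_vu] := ltnP (pos c u) (pos c v).
  left; rewrite /cyc_next Wu Wv uv; apply/forall_inP => w Ww.
  have := hh w Ww; rewrite !(cyc_ordered3 c) pos_id; clear -lt_uv vd; lia.
right; clear -uv' lt_vu cd' ud vd hd hc.
by split; apply: (@pos_inj n c); rewrite ?pos_id; lia.
Qed.

(** A diagonal ab crossed by no edge would lie in an inner region with at least
    four corners. Such a region is a minimal polygon W through a and b all of
    whose sides are edges: an edge uv that is a diagonal of W does not cross ab,
    so it cuts off a smaller polygon still containing a and b. *)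
Lemma nonadjacent_diagonal a b :
  a \in vset T -> b \in vset T -> a != b -> ~~ adjacent T a b ->
  exists c d, adjacent T c d /\ interlaced (p a) (p b) (p c) (p d).
Proof.
case: triT => _ sides _ faces Ta Tb ab nab.
case: (boolP [exists c, exists d,
    adjacent T c d && interlaced (p a) (p b) (p c) (p d)]).
  by case/existsP=> c /existsP[d /andP[]]; exists c, d.
move=> nocut; exfalso.
have nol c d : adjacent T c d -> ~~ interlaced (p a) (p b) (p c) (p d).
  move=> cd; apply: contra nocut => l.
  by apply/existsP; exists c; apply/existsP; exists d; rewrite cd.
pose P (W : {set 'I_n}) := [&& a \in W, b \in W, W \subset vset T
  & [forall c, forall d, cyc_next W c d ==> adjacent T c d]].
have PT : P (vset T).
  rewrite /P Ta Tb subxx; apply/forallP=> c; apply/forallP=> d.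
  by apply/implyP/sides.
have [W /minsetP[/and4P[Wa Wb WT /forallP/(_ _)/forallP nextW] minW] _] :=
  minset_exists PT.
have next c d : cyc_next W c d -> adjacent T c d by apply/implyP/nextW.
have notnext_ab : ~~ cyc_next W a b.
  by apply: contra nab => /next.
have notnext_ba : ~~ cyc_next W b a.
  by apply: contra nab => /next; rewrite adjacentC.
have sep u v : u \in W -> v \in W -> u != v -> ~~ cyc_next W u v ->
    exists2 c, c \in W & cyc_ordered [:: u; c; v].
  move=> Wu Wv uv; rewrite /cyc_next Wu Wv uv /= => /forall_inPn[c Wc /negPn h].
  by exists c.
have [c Wc acb] := sep a b Wa Wb ab notnext_ab.
have [d Wd bda] : exists2 d, d \in W & cyc_ordered [:: b; d; a].
  by apply: sep; rewrite // eq_sym.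
(* As ab is not a side of W, there is a corner on each side of ab. *)
have sz : 3 < #|W|.
  rewrite cardE; apply: (@uniq_leq_size _ [:: a; b; c; d]); last first.
    by move=> v; rewrite mem_enum !inE => /or4P[] /eqP->.
  rewrite /= !inE !negb_or ab /= -!andbA.
  move: acb bda; rewrite !(cyc_ordered3 x) => acb bda.
  by apply/and4P; split=> //; rewrite -?(pos_eq x) -?andbA;
    clear -acb bda; lia.
have: inner_region T W.
  split=> //; first exact: ltnW sz.
  move=> u v Wu Wv uv; apply/negPn; rewrite negb_or.
  apply/negP => /andP[nuv nvu].
  have neq := adjacent_neq uv.
  (* The edge uv does not cross ab, so a and b lie on the same arc from u to v
     or from v to u. *)
  wlog : u v Wu Wv uv nuv nvu neq /
      ~~ cyc_ordered [:: u; v; a] && ~~ cyc_ordered [:: u; v; b].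
    move=> wl; case: (boolP (~~ cyc_ordered [:: u; v; a] &&
        ~~ cyc_ordered [:: u; v; b])).
      exact: (wl u v).
    move=> h; apply: (wl v u) => //; [by rewrite adjacentC|by rewrite eq_sym|].
    move: neq ab (nol _ _ uv) h; rewrite -!(pos_eq x) !(cyc_ordered3 x); clear.
    chordlia.
  case/andP=> au bu; pose W' := [set w in W | ~~ cyc_ordered [:: u; v; w]].
  have [||f Wf vfu] := sep v u Wv Wu; rewrite 1?eq_sym //.
  have W'W : W' \subset W by apply/subsetP=> w; rewrite inE => /andP[].
  have: f \in W' = false.
    move: vfu; rewrite inE Wf !(cyc_ordered3 x); clear; lia.
  rewrite (minW W') ?Wf //; rewrite /P !inE Wa Wb au bu (subset_trans W'W) //=.
  apply/forallP=> i; apply/forallP=> j; apply/implyP => /cyc_next_arc.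
  case=> // [/next//|[-> ->]]; by rewrite adjacentC.
by move/faces=> W3; rewrite W3 in sz.
Qed.

End Diagonals.

(** * Leaves and sides of the graph *)

Section Star.
Variables (n : nat) (x : 'I_n) (G T : sgraph 'I_n).
Hypothesis xG : x \notin vset G.
Hypothesis TG : full_subgraph T G.
Hypothesis polyT : [/\ polygon_triangulation T,
              ord_pred x \in vset T & ordS x \in vset T].
Hypothesis outer_degree1 : forall v : 'I_n,
  v \in vset G -> v \notin vset T -> degree G v = 1.
Hypothesis leaf_place : forall l : 'I_n, l \in vset G -> degree G l = 1 ->
       (exists2 v : 'I_n, max_below x (vset T) l v & adjacent G l v) \/
       (exists2 v : 'I_n, min_above x (vset T) l v & adjacent G l v).
Hypothesis leaf_order : forall t1 t2 l1 l2 : 'I_n,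
       t1 \in vset T -> t2 \in vset T -> cyc_lt x t1 t2 ->
       leaf G l1 -> adjacent G l1 t1 ->
       leaf G l2 -> adjacent G l2 t2 ->
       cyc_lt x l1 l2.
Hypothesis end_edges : [/\ ord_pred (ord_pred x) \in vset G,
              ordS (ordS x) \in vset G,
              adjacent G (ord_pred (ord_pred x)) (ord_pred x)
            & adjacent G (ordS x) (ordS (ordS x))].

Notation p := (pos x).
Notation VT := (vset T).

Definition near (v w : 'I_n) : bool :=
  [forall t in VT, ~~ between (p t) (p v) (p w)].

Lemma VT_VG t : t \in VT -> t \in vset G.
Proof. by case: TG => /subsetP s _; apply: s. Qed.

Lemma adjacentT a b :
  adjacent T a b = [&& adjacent G a b, a \in VT & b \in VT].
Proof.
case: TG => _ eE; rewrite /adjacent eE inE; congr (_ && _).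
by rewrite subUset !sub1set.
Qed.

Lemma VG_pos v : v \in vset G -> 0 < p v.
Proof. by move=> Gv; rewrite pos_gt0; apply: contraNneq xG => <-. Qed.

Lemma first_pos : p (ordS x) = 1.
Proof.
case: polyT => _ _ /VT_VG/VG_pos; rewrite pos_ordS pos_id.
by case: ifP.
Qed.

Lemma second_pos : p (ordS (ordS x)) = 2.
Proof.
case: end_edges => _ /VG_pos + _ _; rewrite pos_ordS first_pos.
by case: ifP.
Qed.

Lemma last_pos : p (ord_pred x) = n.-1.
Proof. by rewrite pos_ord_pred pos_id. Qed.

Lemma penultimate_pos : p (ord_pred (ord_pred x)) = n.-2.
Proof.
rewrite pos_ord_pred last_pos; case: polyT => _ /VT_VG/VG_pos + _.
by rewrite last_pos; case: n => [|[]].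
Qed.

Lemma side_adjacent a b :
  a \in VT -> b \in VT -> a != b -> near a b -> adjacent G a b.
Proof.
move=> Ta Tb ab /forall_inP nab; case: polyT => -[_ sides _ _] _ _.
suff: adjacent T a b by rewrite adjacentT => /andP[].
move: (ab); rewrite -(pos_eq x) neq_ltn => /orP[lt|lt]; last rewrite adjacentC;
  apply: sides; rewrite /cyc_next Ta Tb ?ab 1?eq_sym ?ab;
  apply/forall_inP => c /nab; rewrite (cyc_ordered3 x);
  move: lt; clear; chordlia.
Qed.

(** With degree 1, the neighbour granted by the placement condition is the only
    one, so every edge at l ends in T and stays in one gap of T. *)
Lemma leaf_adjacent l v :
  l \notin VT -> adjacent G l v -> [/\ leaf G l, v \in VT & near l v].
Proof.
move=> Tl lv; have Gl := adjacent_vset lv; have dl := outer_degree1 Gl Tl.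
rewrite /leaf Gl dl; have ltE := cyc_ltE x.
case: (leaf_place Gl dl) => -[w] /and3P[Tw wl /forall_inP wmax];
  move=> /(degree1_adjacent dl lv) vw;
  rewrite vw; split=> //; apply/forall_inP => t Tt; move: (wmax t Tt) wl;
  rewrite !ltE -(pos_eq x); clear; chordlia.
Qed.

(** Two leaf edges can only cross inside a common gap of T, where the order
    condition on leaves separates the leaves of its two ends. *)
Lemma edges_noncrossing a0 b0 c0 d0 :
  adjacent G a0 b0 -> adjacent G c0 d0 ->
  ~~ interlaced (p a0) (p b0) (p c0) (p d0).
Proof.
have TT a b c d : adjacent G a b -> adjacent G c d -> a \in VT -> b \in VT ->
    c \in VT -> d \in VT -> ~~ interlaced (p a) (p b) (p c) (p d).
  move=> ab cd Ta Tb Tc Td; case: polyT => -[_ _ nc _] _ _.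
  have Tab : adjacent T a b by rewrite adjacentT ab Ta Tb.
  have Tcd : adjacent T c d by rewrite adjacentT cd Tc Td.
  apply: contra (nc _ _ Tab Tcd) => l; apply/(crossingP x).
  exists a, c, b, d; split=> //; rewrite !inE ?eqxx ?orbT ?andbT -!(pos_eq x);
    move: l; clear; chordlia.
have TL a b c d : adjacent G a b -> adjacent G c d -> a \in VT -> b \in VT ->
    c \notin VT -> ~~ interlaced (p a) (p b) (p c) (p d).
  move=> ab cd Ta Tb Tc; have [_ Td /forall_inP cn] := leaf_adjacent Tc cd.
  move: (cn a Ta) (cn b Tb); clear; chordlia.
have LL a b c d : adjacent G a b -> adjacent G c d -> a \notin VT ->
    c \notin VT -> ~~ interlaced (p a) (p b) (p c) (p d).
  move=> ab cd Ta Tc; have [ld Td /forall_inP cn] := leaf_adjacent Tc cd.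
  have [lb Tb /forall_inP an] := leaf_adjacent Ta ab.
  have h := leaf_order Tb Td _ lb ab ld cd.
  have h' := leaf_order Td Tb _ ld cd lb ab.
  rewrite !cyc_ltE in h h'.
  have := VG_pos (VT_VG Tb); have := VG_pos (VT_VG Td).
  move: (cn b Tb) (an d Td) h h'; clear; chordlia.
have inT a b : adjacent G a b -> a \notin VT -> b \in VT.
  by move=> ab Ta; case: (leaf_adjacent Ta ab).
have gen a b c d : adjacent G a b -> adjacent G c d -> b \in VT -> d \in VT ->
    ~~ interlaced (p a) (p b) (p c) (p d).
  move=> ab cd Tb Td.
  have [Ta|Ta] := boolP (a \in VT); have [Tc|Tc] := boolP (c \in VT).
  - exact: TT.
  - exact: TL.
  - by rewrite interlaced_chords; apply: TL.
  - exact: LL.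
move: a0 b0 c0 d0 => a b c d ab cd.
wlog Tb : a b ab / b \in VT.
  move=> wl; have [Tb|Tb] := boolP (b \in VT); first exact: wl.
  rewrite interlaced_ends; apply: wl; first by rewrite adjacentC.
  by apply: inT Tb; rewrite adjacentC.
wlog Td : c d cd / d \in VT.
  move=> wl; have [Td|Td] := boolP (d \in VT); first exact: wl.
  rewrite interlaced_chords interlaced_ends interlaced_chords; apply: wl.
    by rewrite adjacentC.
  by apply: inT Td; rewrite adjacentC.
exact: gen.
Qed.

(** * The cone and the fan are weakly separated *)

Definition near_nbr t v := adjacent G t v && near t v.

Definition fan : {set {set 'I_n}} :=
  [set B | [exists t in VT, exists u, exists w,
     [&& near_nbr t u, near_nbr t w, p u < p w,
         [forall v, adjacent G t v ==> ~~ (p u < p v < p w)]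
       & B == [set t; u; w]]]].

Definition cone : {set {set 'I_n}} := [set x |: e | e in eset G].

Lemma fanP B : reflect (exists t u w,
     [/\ [/\ t \in VT, near_nbr t u, near_nbr t w & p u < p w],
         forall v, adjacent G t v -> ~~ (p u < p v < p w)
       & B = [set t; u; w]]) (B \in fan).
Proof.
rewrite inE; apply: (iffP exists_inP).
  case=> t Tt /existsP[u /existsP[w /and5P[tu tw uw /forallP h /eqP->]]].
  by exists t, u, w; split=> // v tv; apply: (implyP (h v)).
case=> t [u [w [[Tt tu tw uw] h ->]]]; exists t => //.
apply/existsP; exists u; apply/existsP; exists w.
rewrite tu tw uw eqxx andbT /=.
by apply/forallP=> v; apply/implyP/h.
Qed.

Lemma fan_triangle B : B \in fan -> triangle B.
Proof.
case/fanP=> t [u [w [[Tt /andP[tu _] /andP[tw _] uw] _ ->]]].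
have uw' : u != w by rewrite -(pos_eq x) ltn_eqF.
rewrite /triangle -setUA cardsU1 !inE cards2 uw'.
by rewrite (negPf (adjacent_neq tu)) (negPf (adjacent_neq tw)).
Qed.

Lemma cone_triangle B : B \in cone -> triangle B.
Proof.
case/imsetP=> e Ge ->; rewrite /triangle cardsU1 (eset_card Ge).
by rewrite (contra _ xG) // => /(subsetP (eset_sub Ge)).
Qed.

Lemma cone_cone A B : A \in cone -> B \in cone -> ~~ crossing A B.
Proof.
case/imsetP=> e /edgeP[y [z [yz ->]]] -> /imsetP[f /edgeP[u [v [uv ->]]]] ->.
have lyz := edges_noncrossing yz uv.
have sub (e' f' : {set 'I_n}) a : a \in (x |: e') :\: (x |: f') -> a \in e'.
  by case/setDP=> /setU1P[->|//]; rewrite setU11.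
apply/(crossingP x) => -[a [b [c [d [/sub aA /sub cA /sub bB /sub dB l]]]]].
move: aA cA bB dB l => /set2P[]-> /set2P[]-> /set2P[]-> /set2P[]->;
  move: lyz; clear; chordlia.
Qed.

(** Let vv' be an edge with v outside the fan triangle. If v lies in T, no
    side of the triangle at t can enclose it. If v is a leaf enclosed by
    such a side, then v' is an end of that side. Since u and w are
    consecutive neighbours of t, v' cannot be t. So v' is another corner,
    hence neither b nor d, and the two remaining corners lie on the same
    side of v. *)
Lemma fan_one_side t u w v v' b d :
  t \in VT -> near_nbr t u -> near_nbr t w -> p u < p w ->
  (forall y, adjacent G t y -> ~~ (p u < p y < p w)) ->
  adjacent G v v' -> v \notin [set t; u; w] ->
  b \in [set t; u; w] -> d \in [set t; u; w] -> b != v' -> d != v' ->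
  ~~ (p b < p v < p d).
Proof.
move=> Tt /andP[tu /forall_inP ntu] /andP[tw /forall_inP ntw] uw uwE vv'.
rewrite !inE !negb_or -!(pos_eq x) => /andP[/andP[vt vu] vw].
rewrite !pos_eq => hb hd; rewrite -!(pos_eq x) => bv' dv'.
suff [i1 i2 i3] :
  [/\ ~~ between (p v) (p t) (p u) || [|| p u == p v' | p t == p v'],
     ~~ between (p v) (p t) (p w) || [|| p w == p v' | p t == p v']
   & ~~ between (p v) (p u) (p w) || [|| p u == p v' | p w == p v']].
  by case/orP: hb bv' => [/orP[]|] /eqP->; case/orP: hd dv' => [/orP[]|] /eqP->;
    move: i1 i2 i3 vt vu vw; clear; chordlia.
have [Tv|Tv] := boolP (v \in VT).
  by move: (ntu _ Tv) (ntw _ Tv) vt; clear; rewrite /between; split; lia.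
have [_ Tv' /forall_inP/(_ _ Tt) nvv'] := leaf_adjacent Tv vv'.
have l1 := edges_noncrossing vv' tu; have l2 := edges_noncrossing vv' tw.
move: (ntu _ Tv') (ntw _ Tv').
have [v't|v't] := eqVneq t v'.
  rewrite -v't adjacentC in vv'.
  by move: (uwE _ vv') uw vu vw; rewrite v't eqxx !orbT; clear;
    rewrite /interlaced /between /outside; split; lia.
by move: v't nvv' l1 l2 vt vu vw; rewrite -(pos_eq x); clear;
  rewrite /interlaced /between /outside; split; lia.
Qed.

Lemma cone_fan A B : A \in cone -> B \in fan -> ~~ crossing A B.
Proof.
case/imsetP=> e /edgeP[y [z [yz ->]]] ->.
case/fanP=> t [u [w [[Tt tu tw uw] uwE ->]]].
have side v v' b d := @fan_one_side t u w v v' b d Tt tu tw uw uwE.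
case/andP: tu => tu _; case/andP: tw => tw _.
have zy : adjacent G z y by rewrite adjacentC.
have l1 := edges_noncrossing yz tu; have l2 := edges_noncrossing yz tw.
apply/(crossingP x) => -[a [b [c [d []]]]].
have inA v : v \in (x |: [set y; z]) :\: [set t; u; w] ->
    [|| v == x, v == y | v == z] && (v \notin [set t; u; w]).
  by rewrite in_setD in_setU1 in_set2 andbC.
have inB v : v \in [set t; u; w] :\: (x |: [set y; z]) ->
    [/\ v \in [set t; u; w], v != y & v != z].
  by case/setDP=> ->; rewrite in_setU1 in_set2 !negb_or => /and3P[].
move=> /inA/andP[ha Ba] /inA/andP[hc Bc] /inB[Bb by_ bz] /inB[Bd dy dz].
(* If yz separates u from w, it separates t from one of them, as t is not an
   end of yz; the edge from t to that one then crosses yz. *)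
have straddle : y \notin [set t; u; w] -> z \notin [set t; u; w] ->
    interlaced (p y) (p z) (p b) (p d) -> False.
  rewrite !inE !negb_or -!(pos_eq x).
  move=> /andP[/andP[yt _] _] /andP[/andP[zt _] _].
  move: l1 l2 yt zt Bb Bd; rewrite !inE.
  move=> l1 l2 yt zt /orP[/orP[]|] /eqP-> /orP[/orP[]|] /eqP->;
    by move: l1 l2 yt zt; clear; chordlia.
case/or3P: ha hc Ba Bc => /eqP-> /or3P[] /eqP-> Ba Bc; rewrite ?pos_id.
- by clear; chordlia.
- have := side y z b d yz Bc Bb Bd bz dz.
  have := side y z d b yz Bc Bd Bb dz bz.
  by clear; chordlia.
- have := side z y b d zy Bc Bb Bd by_ dy.
  have := side z y d b zy Bc Bd Bb dy by_.
  by clear; chordlia.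
- have := side y z b d yz Ba Bb Bd bz dz.
  have := side y z d b yz Ba Bd Bb dz bz.
  by clear; chordlia.
- by clear; chordlia.
- exact: straddle.
- have := side z y b d zy Ba Bb Bd by_ dy.
  have := side z y d b zy Ba Bd Bb dy by_.
  by clear; chordlia.
- by rewrite interlaced_ends; apply: straddle.
- by clear; chordlia.
Qed.

(** Nearness keeps the corners of the first triangle from passing t' and those
    of the second from passing t. Two corners in the wrong order would then be
    joined to t and t' by crossing edges. *)
Lemma fan_fan_lt t u w t' u' w' v v' :
  t \in VT -> near_nbr t u -> near_nbr t w ->
  t' \in VT -> near_nbr t' u' -> near_nbr t' w' -> p t < p t' ->
  v \in [set t; u; w] :\: [set t'; u'; w'] ->
  v' \in [set t'; u'; w'] :\: [set t; u; w] -> p v < p v'.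
Proof.
move=> Tt tu tw Tt' tu' tw' tt.
have inD t1 u1 w1 t2 u2 w2 y : near_nbr t1 u1 -> near_nbr t1 w1 ->
    y \in [set t1; u1; w1] :\: [set t2; u2; w2] ->
    [/\ y = t1 \/ near_nbr t1 y, p y != p t2 & y \in [set t1; u1; w1]].
  move=> tu1 tw1; case/setDP=> yB ny; rewrite yB pos_eq.
  move: yB ny; rewrite !inE !negb_or => h /andP[/andP[-> _] _]; split=> //.
  by case/orP: h => [/orP[]|] /eqP->; tauto.
move=> /(inD _ _ _ _ _ _ _ tu tw)[hv vt' vB].
case/setDP=> v'B nv'; have vv' : p v != p v'.
  by rewrite pos_eq; apply: contraNneq nv' => <-.
have /(inD _ _ _ _ _ _ _ tu' tw')[hv' v't _] :
    v' \in [set t'; u'; w'] :\: [set t; u; w] by rewrite inE nv'.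
case: hv vt' vv' => [->|/andP[tv /forall_inP/(_ _ Tt') ntv]] vt' vv';
  case: hv' v't vv' => [->|/andP[tv' /forall_inP/(_ _ Tt) ntv']] v't vv' //.
- by move: ntv' tt v't; clear; chordlia.
- by move: ntv tt vt'; clear; chordlia.
by move: (edges_noncrossing tv tv') ntv ntv' tt v't vt' vv'; clear; chordlia.
Qed.

Lemma fan_fan A B : A \in fan -> B \in fan -> ~~ crossing A B.
Proof.
case/fanP=> t [u [w [[Tt tu tw uw] uwE ->]]].
case/fanP=> t' [u' [w' [[Tt' tu' tw' uw'] uwE' ->]]].
apply/(crossingP x) => -[a [b [c [d [Aa Ac Bb Bd l]]]]].
case: (ltngtP (p t) (p t')) => [tt|tt|/pos_inj tt].
- have before v v' := @fan_fan_lt t u w t' u' w' v v' Tt tu tw Tt' tu' tw' tt.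
  move: (before _ _ Aa Bb) (before _ _ Aa Bd).
  move: (before _ _ Ac Bb) (before _ _ Ac Bd) l.
  by clear; chordlia.
- have before v v' := @fan_fan_lt t' u' w' t u w v v' Tt' tu' tw' Tt tu tw tt.
  move: (before _ _ Bb Aa) (before _ _ Bd Aa).
  move: (before _ _ Bb Ac) (before _ _ Bd Ac) l.
  by clear; chordlia.
subst t'.
case/andP: tu => tu _; case/andP: tw => tw _.
case/andP: tu' => tu' _; case/andP: tw' => tw' _.
have inD u1 w1 u2 w2 v : v \in [set t; u1; w1] :\: [set t; u2; w2] ->
    v = u1 \/ v = w1.
  by case/setDP; rewrite !inE => /orP[/orP[]|] /eqP->; rewrite ?eqxx //; auto.
have k1 := uwE _ tu'; have k2 := uwE _ tw'.
have k3 := uwE' _ tu; have k4 := uwE' _ tw.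
move: Aa Ac Bb Bd l => /inD[]-> /inD[]-> /inD[]-> /inD[]->;
  by move: uw uw' k1 k2 k3 k4; clear; chordlia.
Qed.

(** * Every non-edge is blocked *)

Lemma last_T_below b : 1 < p b -> exists v, [/\ v \in VT, p v < p b &
   forall s, s \in VT -> p s < p b -> p s <= p v].
Proof.
move=> b1; have P0 : (ordS x \in VT) && (p (ordS x) < p b).
  by rewrite first_pos b1; case: polyT => _ _ ->.
case: (arg_maxnP (P := [pred v | (v \in VT) && (p v < p b)]) p P0).
move=> v /andP[Tv vb] vmax.
by exists v; split=> // s Ts sb; apply: vmax; rewrite /= Ts.
Qed.

Lemma first_T_above b : p b < n.-1 -> exists v, [/\ v \in VT, p b < p v &
   forall s, s \in VT -> p b < p s -> p v <= p s].
Proof.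
move=> bn; have P0 : (ord_pred x \in VT) && (p b < p (ord_pred x)).
  by rewrite last_pos bn; case: polyT => _ ->.
case: (arg_minnP (P := [pred v | (v \in VT) && (p b < p v)]) p P0).
move=> v /andP[Tv vb] vmin.
by exists v; split=> // s Ts sb; apply: vmin; rewrite /= Ts.
Qed.

(** The vertex of T preceding both b and t is joined to t by a side. Only
    t = x+1 has no such vertex; its neighbour x+2 serves there. *)
Lemma neighbour_below t b : t \in VT -> near t b -> b \notin VT -> b != x ->
  ~~ adjacent G t b -> exists2 u, near_nbr t u & p u < p b.
Proof.
move=> Tt /forall_inP ntb Tb bx tb.
have tneb : p t != p b by rewrite pos_eq; apply: contraNneq Tb => <-.
have Tne s : s \in VT -> p s != p b.
  by move=> Ts; rewrite pos_eq; apply: contraNneq Tb => <-.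
have b0 : 0 < p b by rewrite pos_gt0.
case: polyT => _ _ Tf; case: end_edges => _ _ _ fs.
have [tf|tf] := eqVneq t (ordS x).
  exists (ordS (ordS x)).
    rewrite /near_nbr tf fs; apply/forall_inP => s _.
    by rewrite first_pos second_pos; clear; chordlia.
  have sb : p (ordS (ordS x)) != p b.
    by rewrite pos_eq; apply: contraNneq tb => <-; rewrite tf.
  move: sb (Tne _ Tf); rewrite first_pos second_pos; move: b0; clear; lia.
pose c := if p b < p t then b else t.
have c1 : 1 < p c.
  have := Tne _ Tf; move: tf; rewrite -(pos_eq x) first_pos.
  have := VG_pos (VT_VG Tt); rewrite /c; move: b0; clear; case: ifP; lia.
have [v [Tv vc vmax]] := last_T_below c1.
have vt : p v < p t by move: vc tneb; rewrite /c; clear; case: ifP; lia.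
have ntv : near t v.
  apply/forall_inP => s Ts.
  have := vmax s Ts; have := ntb s Ts; have := Tne s Ts.
  by move: vc vt tneb; rewrite /c; clear; case: ifP; chordlia.
exists v; last by move: vc tneb; rewrite /c; clear; case: ifP; lia.
by rewrite /near_nbr ntv side_adjacent // eq_sym -(pos_eq x) ltn_eqF.
Qed.

Lemma neighbour_above t b : t \in VT -> near t b -> b \notin VT -> b != x ->
  ~~ adjacent G t b -> exists2 u, near_nbr t u & p b < p u.
Proof.
move=> Tt /forall_inP ntb Tb bx tb.
have tneb : p t != p b by rewrite pos_eq; apply: contraNneq Tb => <-.
have Tne s : s \in VT -> p s != p b.
  by move=> Ts; rewrite pos_eq; apply: contraNneq Tb => <-.
have b0 := pos_ltn x b.
case: polyT => _ Tf _; case: end_edges => _ _ fs _.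
have [tf|tf] := eqVneq t (ord_pred x).
  exists (ord_pred (ord_pred x)).
    rewrite /near_nbr tf adjacentC fs; apply/forall_inP => s _.
    by rewrite last_pos penultimate_pos; clear; chordlia.
  have sb : p (ord_pred (ord_pred x)) != p b.
    by rewrite pos_eq; apply: contraNneq tb => <-; rewrite tf adjacentC.
  move: sb (Tne _ Tf); rewrite last_pos penultimate_pos; move: b0; clear; lia.
pose c := if p t < p b then b else t.
have c1 : p c < n.-1.
  have := Tne _ Tf; move: tf; rewrite -(pos_eq x) last_pos.
  have := pos_ltn x t; rewrite /c; move: b0; clear; case: ifP; lia.
have [v [Tv vc vmin]] := first_T_above c1.
have vt : p t < p v by move: vc tneb; rewrite /c; clear; case: ifP; lia.
have ntv : near t v.
  apply/forall_inP => s Ts.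
  have := vmin s Ts; have := ntb s Ts; have := Tne s Ts.
  by move: vc vt tneb; rewrite /c; clear; case: ifP; chordlia.
exists v; last by move: vc tneb; rewrite /c; clear; case: ifP; lia.
by rewrite /near_nbr ntv side_adjacent // -(pos_eq x) ltn_eqF.
Qed.

Lemma fan_around t b : t \in VT -> near t b -> b \notin VT -> b != x ->
  ~~ adjacent G t b ->
  exists u w, [/\ [set t; u; w] \in fan, adjacent G t u, adjacent G t w
    & p u < p b < p w].
Proof.
move=> Tt tb Tb bx ntb.
have [u0 tu0 u0b] := neighbour_below Tt tb Tb bx ntb.
have [w0 tw0 w0b] := neighbour_above Tt tb Tb bx ntb.
have P0 : near_nbr t u0 && (p u0 < p b) by rewrite tu0.
have Q0 : near_nbr t w0 && (p b < p w0) by rewrite tw0.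
case: (arg_maxnP (P := [pred v | near_nbr t v && (p v < p b)]) p P0).
move=> u /andP[tu ub] umax.
case: (arg_minnP (P := [pred v | near_nbr t v && (p b < p v)]) p Q0).
move=> w /andP[tw bw] wmin.
case/andP: (tu) => atu /forall_inP ntu; case/andP: (tw) => atw /forall_inP ntw.
exists u, w; rewrite ub bw; split=> //; apply/fanP; exists t, u, w; split=> //.
  by split=> //; apply: ltn_trans bw.
move=> v tv; apply/negP=> uvw.
have vb : p v != p b by rewrite pos_eq; apply: contraNneq ntb => <-.
have vt : p t != p v by rewrite pos_eq (adjacent_neq tv).
have ntv : near_nbr t v.
  rewrite /near_nbr tv; apply/forall_inP => s Ts.
  by move: (ntu s Ts) (ntw s Ts) uvw vt; clear; chordlia.
have := umax v; have := wmin v; rewrite /= ntv /=; move: uvw vb; clear; lia.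
Qed.

Lemma fan_pos B v : B \in fan -> v \in B -> 0 < p v.
Proof.
case/fanP=> t [u [w [[Tt /andP[tu _] /andP[tw _] _] _ ->]]].
rewrite adjacentC in tu; rewrite adjacentC in tw.
rewrite !inE => /orP[/orP[]|] /eqP->; apply: VG_pos; first exact: VT_VG.
  exact: adjacent_vset tu.
exact: adjacent_vset tw.
Qed.

Lemma fan_crossing B (e : {set 'I_n}) v u w :
  B \in fan -> v \in e :\: B -> u \in B :\: e -> w \in B :\: e ->
  p u < p v < p w -> crossing (x |: e) B.
Proof.
move=> FB /setDP[ev Bv] /setDP[Bu eu] /setDP[Bw ew] uvw.
have ux : u != x by rewrite -pos_gt0; apply: fan_pos Bu.
have wx : w != x by rewrite -pos_gt0; apply: fan_pos Bw.
have Bx : x \notin B.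
  by apply/negP => /(fan_pos FB); rewrite pos_id.
apply/(crossingP x); exists x, u, v, w.
rewrite !inE eqxx ev Bu Bw Bx Bv !negb_or.
rewrite ux wx eu ew orbT; split=> //; move: uvw (fan_pos FB Bu); rewrite pos_id.
by clear; chordlia.
Qed.

Lemma blocked_by_edge a b c d : a != x -> b != x ->
  adjacent G c d -> interlaced (p a) (p b) (p c) (p d) ->
  exists2 B, B \in cone :|: fan & crossing (x |: [set a; b]) B.
Proof.
move=> ax bx cd l; exists (x |: [set c; d]); first by rewrite inE imset_f.
have c0 := VG_pos (adjacent_vset cd); rewrite adjacentC in cd.
have d0 := VG_pos (adjacent_vset cd).
rewrite -!pos_gt0 in ax bx.
apply/(crossingP x); exists a, c, b, d.
by split; rewrite ?inE ?eqxx ?orbT -?(pos_eq x) ?pos_id //=;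
  move: l ax bx c0 d0; rewrite -?(pos_eq x) ?pos_id; clear; chordlia.
Qed.

(** The edges sb and ta would cross, so one of them is missing, say sb. Take the
    consecutive neighbours u, w of s around b. Either u lies after a, so that su
    crosses ab, or the chord sw separates b from x and has neither end among a
    and b. *)
Lemma blocked_gap a b s t :
  s \in VT -> t \in VT -> near s t -> a != x -> b != x ->
  a \notin VT -> b \notin VT ->
  p s < p a -> p a < p b -> p b < p t ->
  exists2 B, B \in cone :|: fan & crossing (x |: [set a; b]) B.
Proof.
move=> Ts Tt /forall_inP st ax bx Ta Tb sa ab bt.
have sb : near s b.
  by apply/forall_inP => r /st; move: sa ab bt; clear; chordlia.
have ta : near t a.
  by apply/forall_inP => r /st; move: sa ab bt; clear; chordlia.
have [asb|nsb] := boolP (adjacent G s b); last first.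
  have [u [w [FB asu asw /andP[ub bw]]]] := fan_around Ts sb Tb bx nsb.
  have [au|ua] := ltnP (p a) (p u).
    by apply: blocked_by_edge asu _ => //; move: sa au ub; clear; chordlia.
  exists [set s; u; w]; first by rewrite inE FB orbT.
  apply: (@fan_crossing _ _ b s w) => //.
  - by rewrite !inE !negb_or eqxx orbT andbT -!(pos_eq x);
      move: sa ab ub bw; clear; lia.
  - by rewrite !inE !negb_or eqxx /= andbT -!(pos_eq x);
      move: sa ab ub bw; clear; lia.
  - by rewrite !inE !negb_or eqxx !orbT andbT -!(pos_eq x);
      move: sa ab ub bw; clear; lia.
  - by move: sa ab ub bw; clear; lia.
have [ata|nta] := boolP (adjacent G t a).
  have := edges_noncrossing asb ata; move: sa ab bt; clear; chordlia.
have [u [w [FB atu atw /andP[ua aw]]]] := fan_around Tt ta Ta ax nta.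
have [wb|bw] := ltnP (p w) (p b).
  by apply: blocked_by_edge atw _ => //; move: wb aw bt; clear; chordlia.
exists [set t; u; w]; first by rewrite inE FB orbT.
apply: (@fan_crossing _ _ a u t) => //.
- by rewrite !inE !negb_or eqxx /= andbT -!(pos_eq x);
    move: bt ab ua aw; clear; lia.
- by rewrite !inE !negb_or eqxx !orbT /= andbT -!(pos_eq x);
    move: bt ab ua aw; clear; lia.
- by rewrite !inE !negb_or eqxx /= andbT -!(pos_eq x);
    move: bt ab ua aw; clear; lia.
- by move: bt ab ua aw; clear; lia.
Qed.

Lemma blocked_at a b : a \in VT -> b \notin VT -> b != x -> near a b ->
  ~~ adjacent G a b ->
  exists2 B, B \in cone :|: fan & crossing (x |: [set a; b]) B.
Proof.
move=> Ta Tb bx nab adj.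
have [u [w [FB au aw /andP[ub bw]]]] := fan_around Ta nab Tb bx adj.
exists [set a; u; w]; first by rewrite inE FB orbT.
have ab : p b != p a by rewrite pos_eq; apply: contraNneq Tb => ->.
have au' := adjacent_neq au; have aw' := adjacent_neq aw.
rewrite -(pos_eq x) in au'; rewrite -(pos_eq x) in aw'.
apply: (@fan_crossing _ _ b u w) => //; last by rewrite ub.
all: by rewrite !inE !negb_or eqxx ?orbT /= ?andbT -!(pos_eq x);
  move: ub bw ab au' aw'; clear; lia.
Qed.

Lemma blocked a b : a != b -> a != x -> b != x -> ~~ adjacent G a b ->
  exists2 B, B \in cone :|: fan & crossing (x |: [set a; b]) B.
Proof.
move=> ab ax bx nab.
have [/andP[Ta Tb]|] := boolP ((a \in VT) && (b \in VT)).
  have nabT : ~~ adjacent T a b by rewrite adjacentT (negPf nab).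
  case: polyT => pT _ _.
  have [c [d []]] := nonadjacent_diagonal x pT Ta Tb ab nabT.
  by rewrite adjacentT => /and3P[cd _ _] l; apply: blocked_by_edge l.
rewrite negb_and => Tab.
wlog Tb : a b ab ax bx nab Tab / b \notin VT.
  case/orP: (Tab) => [Ta|Tb] wl; last exact: wl.
  by rewrite [ [set a; b] ]setUC; apply: wl;
    rewrite // 1?eq_sym 1?adjacentC 1?orbC //.
have notVT t v : t \in VT -> v \notin VT -> p v != p t.
  by move=> Tt Tv; rewrite pos_eq; apply: contraNneq Tv => ->.
case: polyT => _ Tl Tf.
have b1 : 1 < p b.
  have := notVT _ _ Tf Tb; rewrite first_pos; move: bx.
  by rewrite -pos_gt0; clear; lia.
have bn : p b < n.-1.
  have := notVT _ _ Tl Tb; rewrite last_pos; have := pos_ltn x b.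
  by clear; lia.
have [s [Ts sb smax]] := last_T_below b1.
have [t [Tt bt tmin]] := first_T_above bn.
have st : near s t.
  apply/forall_inP => r Tr.
  move: (smax r Tr) (tmin r Tr) (notVT _ _ Tr Tb) sb bt.
  by clear; chordlia.
have stE : adjacent G s t.
  apply: side_adjacent => //; rewrite -(pos_eq x); move: sb bt; clear; lia.
have nearb r : r = s \/ r = t -> near r b.
  by move=> rst; apply/forall_inP => v /(forall_inP st);
    case: rst => ->; move: sb bt; clear; chordlia.
have [aout|] := boolP ((p a < p s) || (p t < p a)).
  by apply: blocked_by_edge stE _ => //; move: sb bt aout; clear; chordlia.
rewrite negb_or -!leqNgt => /andP[].
rewrite leq_eqVlt => /orP[/eqP/pos_inj sa _|sa].
  by subst a; apply: blocked_at => //; apply: nearb; left.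
rewrite leq_eqVlt => /orP[/eqP/pos_inj ta|at_].
  by subst a; apply: blocked_at => //; apply: nearb; right.
have Ta : a \notin VT.
  by apply/negP => Ta; move: (forall_inP st a Ta) sa at_; clear; chordlia.
move: ab; rewrite -(pos_eq x) neq_ltn => /orP[lt|lt].
  exact: (blocked_gap Ts Tt st).
by rewrite [ [set a; b] ]setUC; apply: (blocked_gap Ts Tt st).
Qed.

(** Needed because the vertices of the link are read off from its triangles: an
    isolated vertex of G would be lost. *)
Lemma vertex_adjacent v : v \in vset G -> exists a, adjacent G v a.
Proof.
move=> Gv; have [Tv|Tv] := boolP (v \in VT); last first.
  by apply: degree_adjacent; rewrite outer_degree1.
case: end_edges => _ _ _ fs.
have [->|vf] := eqVneq v (ordS x); first by exists (ordS (ordS x)).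
have v1 : 1 < p v.
  by move: vf (VG_pos Gv); rewrite -(pos_eq x) first_pos; clear; lia.
have [s [Ts sv smax]] := last_T_below v1.
exists s; apply: side_adjacent => //.
  by rewrite -(pos_eq x); move: sv; clear; lia.
by apply/forall_inP => r /smax; move: sv; clear; chordlia.
Qed.

(** * The link of a maximal extension *)

Lemma maximal_family_with_star :
  exists2 F : {set {set 'I_n}}, maximal_ws_family F & graph_at F x = G.
Proof.
have ws0 : ws_family (cone :|: fan).
  apply/andP; split; apply/forall_inP => A.
    by case/setUP=> [/cone_triangle|/fan_triangle].
  move=> FA; apply/forall_inP => B FB.
  case/setUP: FA => FA; case/setUP: FB => FB.
  - exact: cone_cone.
  - exact: cone_fan.
  - by apply/negP => /(crossing_sym x); apply/negP/cone_fan.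
  - exact: fan_fan.
have [F maxF sub] := maxset_exists ws0; exists F => //.
have /andP[/forall_inP tri /forall_inP ws] := maxsetp maxF.
have edge a b : a != b -> a != x -> b != x -> x |: [set a; b] \in F ->
    adjacent G a b.
  move=> ab ax bx FA; apply/negPn/negP => /(blocked ab ax bx)[B FB].
  by apply/negP/(forall_inP (ws _ FA))/(subsetP sub).
have coneF e : e \in eset G -> x |: e \in F.
  by move=> Ge; apply: (subsetP sub); rewrite inE imset_f.
have xe e : e \in eset G -> x \notin e.
  by move=> Ge; apply: contra xG => /(subsetP (eset_sub Ge)).
apply: sgraph_eq; apply/setP => /=.
  move=> a; rewrite inE; apply/andP/idP.
    case=> ax /exists_inP[C]; rewrite inE => /andP[FC xC] aC.
    have /eqP := tri C FC.
    rewrite (cardsD1 x) xC (cardsD1 a) !inE ax aC => -[] /eqP/cards1P[b bE].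
    have: b \in C :\ x :\ a by rewrite bE set11.
    rewrite !inE => /and3P[ba bx bC].
    apply: (@adjacent_vset _ _ a b); apply: edge => //; first by rewrite eq_sym.
    rewrite -bE setD1K ?setD1K // !inE ?ax //.
  move=> Ga; split; first by apply: contraNneq xG => <-.
  have [b ab] := vertex_adjacent Ga.
  apply/exists_inP; exists (x |: [set a; b]); rewrite !inE ?eqxx ?orbT //.
  by rewrite coneF.
move=> e; rewrite !inE eqxx andbT; apply/and3P/idP.
  case=> /cards2P[a [b [ab ->]]]; rewrite !inE negb_or !(eq_sym x).
  move=> /andP[ax bx].
  exact: edge.
by move=> Ge; rewrite xe // coneF // (eset_card Ge).
Qed.

End Star.

Theorem theorem1p20 (n : nat) (x : 'I_n) (G T : sgraph 'I_n)
    (hG : x \notin vset G)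
    (hT : full_subgraph T G)
    (h1 : [/\ polygon_triangulation T,
              ord_pred x \in vset T & ordS x \in vset T])
    (h2 : forall v : 'I_n, v \in vset G -> v \notin vset T -> degree G v = 1)
    (h3 : forall l : 'I_n, l \in vset G -> degree G l = 1 ->
       (exists2 v : 'I_n, max_below x (vset T) l v & adjacent G l v) \/
       (exists2 v : 'I_n, min_above x (vset T) l v & adjacent G l v))
    (h4 : forall t1 t2 l1 l2 : 'I_n,
       t1 \in vset T -> t2 \in vset T -> cyc_lt x t1 t2 ->
       leaf G l1 -> adjacent G l1 t1 ->
       leaf G l2 -> adjacent G l2 t2 ->
       cyc_lt x l1 l2)
    (h5 : [/\ ord_pred (ord_pred x) \in vset G,
              ordS (ordS x) \in vset G,
              adjacent G (ord_pred (ord_pred x)) (ord_pred x)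
            & adjacent G (ordS x) (ordS (ordS x))]) :
  exists2 F : {set {set 'I_n}}, maximal_ws_family F & graph_at F x = G.
Proof. exact: (maximal_family_with_star hG hT h1 h2 h3 h4 h5). Qed.
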